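(* Let $A_G=\bigoplus_{g\in G}A_g$ be a $G$-graded algebra over a field $\mathbb{F}$ and let $M$ be any left $A_e$-module. Then $M$ is restricted from $A_G$ if and only if there exists a $G$-graded left $A_G$-module $W_G=\bigoplus_{g\in G}W_g$ with $W_e\cong M$ (as $A_e$-modules) such that $\mathrm{End}^{\mathrm{r}(G)}_{A_G}(W_G)$ is graded isomorphic to a skew group algebra supported by $G$.
   Context: Algebras are associative and unital. A $G$-graded $\mathbb{F}$-algebra is $A_G=\bigoplus_{g\in G}A_g$ with $A_gA_h\subseteq A_{gh}$; $A_e$ is its base algebra. A $G$-graded left $A_G$-module is $W_G=\bigoplus_gW_g$ with $A_gW_h\subseteq W_{gh}$. $M$ is restricted from $A_G$ if it is the restriction to $A_e$ of some left $A_G$-module. $\mathrm{End}^{\mathrm{r}(G)}_{A_G}(W_G)=\bigoplus_h\mathrm{End}^{\mathrm{r}(h)}_{A_G}(W_G)$, where $\mathrm{End}^{\mathrm{r}(h)}_{A_G}(W_G)$ is the set of $A_G$-endomorphisms mapping $W_g$ into $W_{gh}$ for all $g$; it acts from the right (product $\phi\psi$: first $\phi$, then $\psi$) and is a $G$-graded algebra. A $G$-graded algebra $B_G$ is a skew group algebra (supported by $G$) if there are invertible elements $u_g\in B_g$, $g\in G$, with $u_gu_h=u_{gh}$ for all $g,h\in G$. Graded isomorphic means isomorphic by a degree-preserving algebra isomorphism. *)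

(* Defs.v *)
From HB Require Import structures.
From mathcomp Require Import all_boot all_algebra.
From mathcomp Require Import boolp functions.

Set Implicit Arguments.
Unset Strict Implicit.
Unset Printing Implicit Defensive.

Import GRing.Theory.
Local Open Scope ring_scope.

(* MathComp's [algType] excludes the zero algebra, which must be allowed here: *)
(* it is the graded endomorphism algebra of the zero module.  We therefore     *)
(* present an associative unital F-algebra as a possibly zero ring together    *)
(* with a ring morphism [scal] from F to its centre; the scalar multiple c a   *)
(* is [scal c * a].                                                            *)
HB.mixin Record isPzAlgebra (F : fieldType) A of GRing.PzRing A := {
  scal : {rmorphism F -> A};
  scal_central : forall (c : F) (a : A), scal c * a = a * scal c
}.

#[short(type="pzAlgType")]
HB.structure Definition PzAlgebra (F : fieldType) :=
  {A of GRing.PzRing A & isPzAlgebra F A}.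

Section DirectSum.
Variables (I : choiceType) (V : zmodType).
Implicit Types (C : I -> {pred V}).

(* v lies in the sum of the C i, i ranging over the possibly infinite type I *)
Definition in_sum C (v : V) : Prop :=
  exists (s : seq I) (x : I -> V),
    [/\ uniq s, forall i, x i \in C i & v = \sum_(i <- s) x i].

Definition independent C : Prop :=
  forall (s : seq I) (x : I -> V), uniq s -> (forall i, x i \in C i) ->
    \sum_(i <- s) x i = 0 -> forall i, i \in s -> x i = 0.

Definition direct_sum C : Prop := (forall v, in_sum C v) /\ independent C.

End DirectSum.

HB.mixin Record isGradedAlg (F : fieldType) (G : groupType) A
    of PzAlgebra F A := {
  acomp : G -> {pred A};
  acomp_zmod : forall g, zmod_closed (acomp g);
  acomp_scal : forall g (c : F) a,
    a \in acomp g -> scal (s := A) c * a \in acomp g;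
  acomp_direct : direct_sum acomp;
  acomp_mul : forall g h a b,
    a \in acomp g -> b \in acomp h -> a * b \in acomp (g * h)%g
}.

#[short(type="gradedAlgType")]
HB.structure Definition GradedAlg (F : fieldType) (G : groupType) :=
  {A of PzAlgebra F A & isGradedAlg F G A}.

(* The W_g are automatically F-subspaces, because scal c has degree 1. *)
HB.mixin Record isGradedMod (F : fieldType) (G : groupType)
    (A : gradedAlgType F G) W of GRing.Lmodule A W := {
  wcomp : G -> {pred W};
  wcomp_zmod : forall g, zmod_closed (wcomp g);
  wcomp_direct : direct_sum wcomp;
  wcomp_act : forall g h (a : A) w,
    a \in acomp g -> w \in wcomp h -> a *: w \in wcomp (g * h)%g
}.

#[short(type="gradedModType")]
HB.structure Definition GradedMod (F : fieldType) (G : groupType)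
  (A : gradedAlgType F G) := {W of GRing.Lmodule A W & isGradedMod F G A W}.

Section DirectSumTheory.
Variables (I : choiceType) (V : zmodType) (C : I -> {pred V}).
Hypothesis CZ : forall i, zmod_closed (C i).

Lemma comp_0 i : 0 \in C i. Proof. exact: (CZ i).1. Qed.

Lemma comp_B i v w : v \in C i -> w \in C i -> v - w \in C i.
Proof. exact: (CZ i).2. Qed.

Lemma comp_N i v : v \in C i -> - v \in C i.
Proof. by move=> vC; rewrite -sub0r comp_B ?comp_0. Qed.

Lemma comp_D i v w : v \in C i -> w \in C i -> v + w \in C i.
Proof. by move=> vC wC; rewrite -[w]opprK comp_B ?comp_N. Qed.

(* extend a decomposition by zero to a larger index list *)
Lemma sum_widen (s t : seq I) (x : I -> V) :
  uniq s -> uniq t -> {subset s <= t} ->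
  \sum_(i <- s) x i = \sum_(i <- t) (if i \in s then x i else 0).
Proof.
move=> us ut st; rewrite -big_mkcond -[RHS]big_filter.
apply: perm_big; apply: uniq_perm => //; first exact: filter_uniq.
move=> i; rewrite mem_filter; case: (boolP (i \in s)) => //= is_.
by rewrite (st _ is_).
Qed.

Lemma in_sum_comp i v : v \in C i -> in_sum C v.
Proof.
move=> vC; exists [:: i], (fun j => if j == i then v else 0); split=> //.
  by move=> j; case: eqP => [->|] //; rewrite comp_0.
by rewrite big_seq1 eqxx.
Qed.

Lemma in_sum0 : in_sum C 0.
Proof.
by exists [::], (fun=> 0); split=> //; [move=> i; rewrite comp_0|rewrite big_nil].
Qed.

Lemma in_sumB v w : in_sum C v -> in_sum C w -> in_sum C (v - w).
Proof.
move=> [s [x [us xC ->]]] [t [y [ut yC ->]]].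
pose r := undup (s ++ t).
have ur : uniq r by exact: undup_uniq.
have sr : {subset s <= r} by move=> i is_; rewrite mem_undup mem_cat is_.
have tr : {subset t <= r} by move=> i it; rewrite mem_undup mem_cat it orbT.
exists r, (fun i => (if i \in s then x i else 0) - (if i \in t then y i else 0)).
split=> //.
  by move=> i; apply: comp_B; case: ifP; rewrite ?xC ?yC ?comp_0.
by rewrite (sum_widen _ us ur sr) (sum_widen _ ut ur tr) sumrB.
Qed.

Lemma in_sumD v w : in_sum C v -> in_sum C w -> in_sum C (v + w).
Proof.
move=> vC wC; rewrite -[w]opprK; apply: in_sumB => //.
by rewrite -sub0r; apply: in_sumB => //; exact: in_sum0.
Qed.

Lemma in_sum_sum (J : Type) (r : seq J) (f : J -> V) :
  (forall j, in_sum C (f j)) -> in_sum C (\sum_(j <- r) f j).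
Proof.
by move=> fC; elim/big_ind: _ => //; [exact: in_sum0|exact: in_sumD].
Qed.

End DirectSumTheory.

Section BaseAlgebra.
Variables (F : fieldType) (G : groupType) (A : gradedAlgType F G).

Lemma acomp_mul1l g (a b : A) :
  a \in acomp 1%g -> b \in acomp g -> a * b \in acomp g.
Proof. by move=> aA bA; rewrite -[g]mul1g acomp_mul. Qed.

Lemma acomp_mul1r g (a b : A) :
  a \in acomp g -> b \in acomp 1%g -> a * b \in acomp g.
Proof. by move=> aA bA; rewrite -[g]mulg1 acomp_mul. Qed.

Lemma acomp_one : (1 : A) \in acomp 1%g.
Proof.
have [dec ind] := @acomp_direct F G A.
have [s [x [us xA E1]]] := dec 1.
pose e := if 1%g \in s then x 1%g else 0.
have eA : e \in acomp 1%g.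
  by rewrite /e; case: ifP => _; [exact: xA|exact: (acomp_zmod _).1].
(* e is a right unit on homogeneous elements *)
have ae g a : a \in acomp g -> a * e = a.
  move=> aA; pose r := undup (1%g :: s).
  have ur : uniq r by exact: undup_uniq.
  have sr : {subset s <= r} by move=> i is_; rewrite mem_undup inE is_ orbT.
  have r1 : 1%g \in r by rewrite mem_undup mem_head.
  pose y h := a * (if h \in s then x h else 0) - (if h == 1%g then a else 0).
  pose z k := y (g^-1 * k)%g.
  pose t := [seq (g * h)%g | h <- r].
  have ut : uniq t by rewrite map_inj_uniq //; exact: mulgI.
  have zA k : z k \in acomp k.
    have yA h : y h \in acomp (g * h)%g.
      apply: (comp_B (@acomp_zmod F G A)).
        apply: acomp_mul => //; case: ifP => _; [exact: xA|].
        exact: (acomp_zmod _).1.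
      by case: eqP => [->|_]; [rewrite mulg1|exact: (acomp_zmod _).1].
    by have := yA (g^-1 * k)%g; rewrite mulVKg.
  have sz : \sum_(k <- t) z k = 0.
    rewrite big_map (eq_bigr y) => [|h _]; last by rewrite /z mulKg.
    rewrite sumrB -mulr_sumr -(sum_widen _ us ur sr) -E1 mulr1.
    rewrite (bigD1_seq 1%g) //= eqxx big1 ?addr0 ?subrr // => h /negbTE->.
    by [].
  have := ind t z ut zA sz (g * 1)%g (map_f _ r1).
  by rewrite /z mulKg /y eqxx => /subr0_eq.
suff -> : (1 : A) = e by [].
by rewrite -[e]mul1r {1 2}E1 mulr_suml; apply: eq_bigr => g _; rewrite (ae g).
Qed.

Lemma acomp1_subring : subring_closed (acomp 1%g : {pred A}).
Proof.
split; [exact: acomp_one|exact: (acomp_zmod _).2|].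
by move=> a b aA bA; exact: acomp_mul1l.
Qed.

Lemma acomp1_scal c : (scal c : A) \in acomp 1%g.
Proof. by rewrite -[scal c]mulr1 acomp_scal ?acomp_one. Qed.

Definition base_alg := {a : A | a \in acomp 1%g}.

HB.instance Definition _ := [isSub of base_alg for @sval _ _].
HB.instance Definition _ := [Choice of base_alg by <:].
HB.instance Definition _ :=
  GRing.SubChoice_isSubPzRing.Build A _ base_alg acomp1_subring.

Definition base_scal (c : F) : base_alg := Sub (scal c) (acomp1_scal c).

Fact base_scal_zmod : zmod_morphism base_scal.
Proof. by move=> c d; apply: val_inj; rewrite raddfB /= rmorphB. Qed.

Fact base_scal_monoid : monoid_morphism base_scal.
Proof.
by split=> [|c d]; apply: val_inj; rewrite ?rmorph1 ?rmorphM /= ?rmorph1 ?rmorphM.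
Qed.

HB.instance Definition _ :=
  GRing.isZmodMorphism.Build F base_alg base_scal base_scal_zmod.
HB.instance Definition _ :=
  GRing.isMonoidMorphism.Build F base_alg base_scal base_scal_monoid.

Fact base_scal_central (c : F) (a : base_alg) :
  base_scal c * a = a * base_scal c.
Proof. by apply: val_inj; rewrite !rmorphM /= scal_central. Qed.

HB.instance Definition _ :=
  isPzAlgebra.Build F base_alg base_scal_central.

End BaseAlgebra.

Section Restriction.
Variables (F : fieldType) (G : groupType) (A : gradedAlgType F G).

Definition restrict (N : lmodType A) : Type := N.

HB.instance Definition _ (N : lmodType A) := GRing.Zmodule.on (restrict N).

Section Instance.
Variable N : lmodType A.

Let act (a : base_alg A) (v : restrict N) : restrict N := val a *: (v : N).

Fact restrict_scalerA a b v : act a (act b v) = act (a * b) v.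
Proof. by rewrite /act scalerA rmorphM. Qed.

Fact restrict_scale1r : left_id 1 act.
Proof. by move=> v; rewrite /act rmorph1 scale1r. Qed.

Fact restrict_scalerDr : right_distributive act +%R.
Proof. by move=> a v w; rewrite /act scalerDr. Qed.

Fact restrict_scalerDl v : {morph act^~ v : a b / a + b}.
Proof. by move=> a b; rewrite /act raddfD scalerDl. Qed.

HB.instance Definition _ := GRing.Zmodule_isLmodule.Build
  (base_alg A) (restrict N)
  restrict_scalerA restrict_scale1r restrict_scalerDr restrict_scalerDl.
End Instance.

(* Being a restriction is read up to isomorphism; by transport of structure    *)
(* one may then take N with the same underlying group as M.                    *)
Definition restricted_from (M : lmodType (base_alg A)) : Prop :=
  exists (N : lmodType A) (f : {linear M -> restrict N}), bijective f.

End Restriction.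

Section Component.
Variables (F : fieldType) (G : groupType) (A : gradedAlgType F G).
Variables (W : gradedModType A) (g : G).

Definition comp_mod := {w : W | w \in wcomp g}.

HB.instance Definition _ := [isSub of comp_mod for @sval _ _].
HB.instance Definition _ := [Choice of comp_mod by <:].
HB.instance Definition _ :=
  GRing.SubChoice_isSubZmodule.Build W _ comp_mod (@wcomp_zmod F G A W g).

Fact comp_act_subproof (a : base_alg A) (w : comp_mod) :
  val a *: val w \in wcomp g.
Proof. by have := wcomp_act _ _ _ _ (valP a) (valP w); rewrite mul1g. Qed.

Let act (a : base_alg A) (w : comp_mod) : comp_mod :=
  Sub (val a *: val w) (comp_act_subproof a w).

Fact comp_scalerA a b w : act a (act b w) = act (a * b) w.
Proof. by apply: val_inj; rewrite /= scalerA. Qed.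

Fact comp_scale1r : left_id 1 act.
Proof. by move=> w; apply: val_inj; rewrite /= scale1r. Qed.

Fact comp_scalerDr : right_distributive act +%R.
Proof. by move=> a v w; apply: val_inj; rewrite /= scalerDr. Qed.

Fact comp_scalerDl v : {morph act^~ v : a b / a + b}.
Proof. by move=> a b; apply: val_inj; rewrite raddfD /= scalerDl. Qed.

HB.instance Definition _ := GRing.Zmodule_isLmodule.Build
  (base_alg A) comp_mod
  comp_scalerA comp_scale1r comp_scalerDr comp_scalerDl.

End Component.

Section GradedEnd.
Variables (F : fieldType) (G : groupType) (A : gradedAlgType F G).
Variable W : gradedModType A.
Implicit Types (f : W -> W) (g h : G).

Definition end_deg h : {pred W -> W} := fun f =>
  `[< linear f /\
      forall g (w : W), w \in wcomp g -> f w \in wcomp (g * h)%g >].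

Lemma end_degP h f : reflect (linear f /\
    forall g (w : W), w \in wcomp g -> f w \in wcomp (g * h)%g)
  (f \in end_deg h).
Proof. exact: asboolP. Qed.

Lemma end_deg_zmod h : zmod_closed (end_deg h).
Proof.
split=> [|f1 f2 /end_degP[l1 d1] /end_degP[l2 d2]]; apply/end_degP; split.
- by move=> a u v /=; rewrite scaler0 addr0.
- by move=> g w _; exact: (wcomp_zmod _).1.
- move=> a u v; rewrite !addrfctE !opprfctE l1 l2 scalerBr.
  by rewrite opprD addrACA.
- by move=> g w wg; apply: (wcomp_zmod _).2; [exact: d1|exact: d2].
Qed.

Definition end_sum : {pred W -> W} := fun f => `[< in_sum end_deg f >].

Lemma end_sumP f : reflect (in_sum end_deg f) (f \in end_sum).
Proof. exact: asboolP. Qed.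

Lemma end_deg_sum h f : f \in end_deg h -> f \in end_sum.
Proof. by move=> fh; apply/end_sumP/(in_sum_comp end_deg_zmod fh). Qed.

Lemma end_sum_zmod : zmod_closed end_sum.
Proof.
split=> [|f1 f2 /end_sumP i1 /end_sumP i2]; apply/end_sumP.
  exact: (in_sum0 end_deg_zmod).
exact: (in_sumB end_deg_zmod).
Qed.

Lemma end_sum_linear f : f \in end_sum -> linear f.
Proof.
move=> /end_sumP[s [x [_ xE ->]]] a u v; rewrite !fct_sumE scaler_sumr -big_split.
by apply: eq_bigr => h _ /=; have /end_degP[l _] := xE h; rewrite l.
Qed.

Lemma end_deg_comp g h f1 f2 :
  f1 \in end_deg g -> f2 \in end_deg h -> f2 \o f1 \in end_deg (g * h)%g.
Proof.
move=> /end_degP[l1 d1] /end_degP[l2 d2]; apply/end_degP; split.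
  by move=> a u v /=; rewrite l1 l2.
by move=> k w wk /=; rewrite mulgA; exact/d2/d1.
Qed.

Lemma linear_fun0 f : linear f -> f 0 = 0.
Proof.
move=> l; have := l 1 0 0; rewrite scale1r addr0 scale1r => /eqP.
by rewrite -subr_eq subrr eq_sym => /eqP.
Qed.

Lemma linear_sum_seq f (J : Type) (r : seq J) (x : J -> W) : linear f ->
  f (\sum_(j <- r) x j) = \sum_(j <- r) f (x j).
Proof.
move=> l; apply: (big_morph f); last exact: linear_fun0.
move=> u v.
by have := l 1 u v; rewrite !scale1r.
Qed.

Lemma end_sum_comp f1 f2 :
  f1 \in end_sum -> f2 \in end_sum -> f2 \o f1 \in end_sum.
Proof.
move=> /end_sumP[s [x [_ xE ->]]] /end_sumP[t [y [_ yE ->]]].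
have -> : (\sum_(h <- t) y h) \o (\sum_(g <- s) x g) =
    \sum_(h <- t) \sum_(g <- s) (y h \o x g).
  apply/funext => w /=; rewrite !fct_sumE; apply: eq_bigr => h _.
  have /end_degP[l _] := yE h; rewrite fct_sumE.
  by rewrite linear_sum_seq.
apply/end_sumP; apply: (in_sum_sum end_deg_zmod) => h.
apply: (in_sum_sum end_deg_zmod) => g.
exact: (in_sum_comp end_deg_zmod (end_deg_comp (xE g) (yE h))).
Qed.

Lemma end_deg_scal (c : F) : (fun w : W => (scal c : A) *: w) \in end_deg 1%g.
Proof.
apply/end_degP; split=> [a u v|g w wg].
  by rewrite scalerDr !scalerA scal_central.
by rewrite mulg1 -[g]mul1g wcomp_act ?acomp1_scal.
Qed.

Lemma end_deg_id : id \in end_deg 1%g.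
Proof. by apply/end_degP; split=> // g w wg; rewrite mulg1. Qed.

Definition graded_end := {f : W -> W | f \in end_sum}.

HB.instance Definition _ := [isSub of graded_end for @sval _ _].
HB.instance Definition _ := [Choice of graded_end by <:].
HB.instance Definition _ :=
  GRing.SubChoice_isSubZmodule.Build (W -> W) _ graded_end end_sum_zmod.

(* endomorphisms act from the right: phi * psi is first phi, then psi *)
Definition end_one : graded_end := Sub id (end_deg_sum end_deg_id).
Definition end_mul (phi psi : graded_end) : graded_end :=
  Sub (val psi \o val phi) (end_sum_comp (valP phi) (valP psi)).

Fact end_mulA : associative end_mul.
Proof. by move=> x y z; apply: val_inj. Qed.
Fact end_mul1r : left_id end_one end_mul.
Proof. by move=> x; apply: val_inj. Qed.
Fact end_mulr1 : right_id end_one end_mul.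
Proof. by move=> x; apply: val_inj. Qed.
Fact end_mulDl : left_distributive end_mul +%R.
Proof.
move=> x y z; apply: val_inj; apply/funext => w.
rewrite raddfD /= !addrfctE /=.
by have := end_sum_linear (valP z) 1 (val x w) (val y w); rewrite !scale1r.
Qed.
Fact end_mulDr : right_distributive end_mul +%R.
Proof. by move=> x y z; apply: val_inj; apply/funext => w; rewrite !raddfD. Qed.

HB.instance Definition _ := GRing.Zmodule_isPzRing.Build graded_end
  end_mulA end_mul1r end_mulr1 end_mulDl end_mulDr.

Definition end_scal (c : F) : graded_end :=
  Sub (fun w : W => (scal c : A) *: w) (end_deg_sum (end_deg_scal c)).

Fact end_scal_zmod : zmod_morphism end_scal.
Proof.
move=> c d; apply: val_inj; apply/funext => w; rewrite raddfB /=.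
by rewrite addrfctE opprfctE rmorphB scalerBl.
Qed.

Fact end_scal_monoid : monoid_morphism end_scal.
Proof.
split=> [|c d]; apply: val_inj; apply/funext => w /=.
  by rewrite rmorph1 scale1r.
by rewrite scalerA -rmorphM mulrC.
Qed.

HB.instance Definition _ :=
  GRing.isZmodMorphism.Build F graded_end end_scal end_scal_zmod.
HB.instance Definition _ :=
  GRing.isMonoidMorphism.Build F graded_end end_scal end_scal_monoid.

Fact end_scal_central (c : F) (phi : graded_end) :
  end_scal c * phi = phi * end_scal c.
Proof.
apply: val_inj; apply/funext => w /=.
have l := end_sum_linear (valP phi).
by have := l (scal c) w 0; rewrite (linear_fun0 l) !addr0.
Qed.

HB.instance Definition _ := isPzAlgebra.Build F graded_end end_scal_central.

Definition end_comp h : {pred graded_end} := [pred phi | val phi \in end_deg h].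

Fact end_comp_zmod h : zmod_closed (end_comp h).
Proof.
have [z0 zB] := end_deg_zmod h.
split=> [|x y]; rewrite !inE ?raddf0 // => xh yh.
by rewrite raddfB; exact: zB.
Qed.

Fact end_comp_mul g h phi psi :
  phi \in end_comp g -> psi \in end_comp h -> phi * psi \in end_comp (g * h)%g.
Proof. by rewrite !inE; exact: end_deg_comp. Qed.

Fact end_comp_scal h (c : F) phi :
  phi \in end_comp h -> scal c * phi \in end_comp h.
Proof.
by move=> ph; rewrite -[h]mul1g; apply: end_comp_mul; rewrite // inE end_deg_scal.
Qed.

Fact end_comp_direct : direct_sum end_comp.
Proof.
split.
  move=> phi; have /end_sumP[s [x [us xE E]]] := valP phi.
  pose y h : graded_end := Sub (x h) (end_deg_sum (xE h)).
  exists s, y; split=> //.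
  by apply: val_inj; rewrite E raddf_sum; apply: eq_bigr.
move=> s x us xE E h hs; apply: val_inj; apply/funext => w; rewrite raddf0.
have [dec ind] := @wcomp_direct F G A W.
have l k : linear (val (x k)) by exact: end_sum_linear (valP _).
have x0 g v : v \in wcomp g -> val (x h) v = 0.
  move=> vg.
  pose z k := val (x (g^-1 * k)%g) v.
  pose t := [seq (g * k)%g | k <- s].
  have ut : uniq t by rewrite map_inj_uniq //; exact: mulgI.
  have zW k : z k \in wcomp k.
    have := xE (g^-1 * k)%g; rewrite inE => /end_degP[_ /(_ g v vg)].
    by rewrite mulVKg.
  have sz : \sum_(k <- t) z k = 0.
    rewrite big_map (eq_bigr (fun k => val (x k) v)) => [|k _].
      by have := congr1 val E; rewrite !raddf_sum raddf0 => /(congr1 (@^~ v));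
         rewrite fct_sumE.
    by rewrite /z mulKg.
  by have := ind t z ut zW sz (g * h)%g (map_f _ hs); rewrite /z mulKg.
have [r [y [_ yW ->]]] := dec w.
by rewrite linear_sum_seq // big1 // => g _; exact: x0 (yW g).
Qed.

HB.instance Definition _ := isGradedAlg.Build F G graded_end
  end_comp_zmod end_comp_scal end_comp_direct end_comp_mul.

End GradedEnd.

Section SkewGroupAlgebra.
Variables (F : fieldType) (G : groupType).

Definition invertible (R : pzRingType) (u : R) : Prop :=
  exists v, u * v = 1 /\ v * u = 1.

Definition skew_group_algebra (B : gradedAlgType F G) : Prop :=
  exists u : G -> B,
    [/\ forall g, u g \in acomp g, forall g, invertible (u g)
      & forall g h, u g * u h = u (g * h)%g].

Definition graded_isomorphic (B C : gradedAlgType F G) : Prop :=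
  exists f : {rmorphism B -> C},
    [/\ bijective f, forall c, f (scal c) = scal c
      & forall g b, b \in acomp g -> f b \in acomp g].

End SkewGroupAlgebra.

(* Main.v *)
Require Import Defs.
From HB Require Import structures.
From mathcomp Require Import all_boot all_algebra.
From mathcomp Require Import boolp functions.

Set Implicit Arguments.
Unset Strict Implicit.
Unset Printing Implicit Defensive.

Import GRing.Theory.
Local Open Scope ring_scope.

(** Both directions trade an A-module N for the graded module N[G] of its
    translates.

    If M is the restriction of N, let N[G] be the group of finitely supported
    functions w : G -> N, where a in A_g acts by (a w)(k) = a w(g^-1 k) and the
    component of degree g consists of the functions supported at g.  Left
    translation by the degree of a commutes with right translation on G, so
    right translation by h is an A-endomorphism of degree h
    ([shift_end_deg]); these maps compose as the elements of G do, which makes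
    the graded endomorphism algebra a skew group algebra
    ([skew_translates]).  Evaluation at 1 identifies the component of degree 1
    with N as a module over the base algebra.

    Conversely, let u_g be the units of degree g of the graded endomorphism
    algebra of W; a graded isomorphism carries them over from the given skew
    group algebra ([skew_transport]).  Folding W onto its component of degree
    1, by applying u_(g^-1) to the part of degree g, is an additive map [fold]
    that is the identity in degree 1 and absorbs every u_h
    ([fold_translation]).  As u_h commutes with A, fold (a (fold w)) and
    fold (a w) agree ([fold_act_fold]): hence a . w := fold (a w) is an action of
    A on W_1, and on A_1 it is the given one, because A_1 W_1 is already in
    degree 1. *)

(** * Maps out of a direct sum *)

Section DirectSumMaps.
Variables (I : choiceType) (V : zmodType) (C : I -> {pred V}).
Hypothesis CZ : forall i, zmod_closed (C i).
Hypothesis CD : direct_sum C.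

Lemma direct_sum_ind (P : V -> Prop) :
  P 0 -> (forall v w, P v -> P w -> P (v + w)) ->
  (forall i v, v \in C i -> P v) -> forall v, P v.
Proof.
move=> P0 PD PC v; have [s [x [_ xC ->]]] := CD.1 v.
by elim/big_ind: _ => // i _; exact: PC (xC i).
Qed.

Variables (U : zmodType) (phi : I -> V -> U).
Hypothesis phiB : forall i, zmod_morphism (phi i).

Let phi0 i : phi i 0 = 0.
Proof. by rewrite -[X in phi i X](subrr 0) phiB subrr. Qed.

Let phi_if i (b : bool) v :
  phi i (if b then v else 0) = if b then phi i v else 0.
Proof. by case: b. Qed.

(** The universal property of a direct sum: a family of additive maps [phi i]
    gives an additive map on V.  It is computed on a chosen decomposition;
    [glue_sum] shows that the choice is immaterial. *)
Definition glue (v : V) : U :=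
  let d := cid (CD.1 v) in
  \sum_(i <- projT1 d) phi i (projT1 (cid (projT2 d)) i).

(** Two decompositions of one element, extended by zero to a common index list,
    agree termwise because the summands are independent. *)
Lemma glue_sum (s : seq I) (x : I -> V) : uniq s -> (forall i, x i \in C i) ->
  glue (\sum_(i <- s) x i) = \sum_(i <- s) phi i (x i).
Proof.
move=> us xC; rewrite /glue; case: cid => t /= p; case: cid => y /= [ut yC E].
pose r := undup (s ++ t).
have ur : uniq r by exact: undup_uniq.
have sr : {subset s <= r} by move=> i ?; rewrite mem_undup mem_cat; apply/orP; left.
have tr : {subset t <= r} by move=> i ?; rewrite mem_undup mem_cat; apply/orP; right.
rewrite (sum_widen _ us ur sr) (sum_widen _ ut ur tr).
apply: eq_big_seq => i ir; rewrite -!phi_if; congr (phi i _).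
apply/eqP; rewrite -subr_eq0; apply/eqP.
pose z i := (if i \in t then y i else 0) - (if i \in s then x i else 0).
apply: (CD.2 r z ur) => // [j|].
  by apply: (comp_B CZ); case: ifP; rewrite ?xC ?yC ?(comp_0 CZ).
by rewrite sumrB -(sum_widen _ us ur sr) -(sum_widen _ ut ur tr) E subrr.
Qed.

Lemma glue_comp i v : v \in C i -> glue v = phi i v.
Proof.
move=> vC; pose x j := if j == i then v else 0.
have xC j : x j \in C j by rewrite /x; case: eqP => [->|]; rewrite ?(comp_0 CZ).
by have := @glue_sum [:: i] x isT xC; rewrite !big_seq1 /x eqxx.
Qed.

Lemma glueB : zmod_morphism glue.
Proof.
move=> v w; have [[s [x [us xC ->]]] [t [y [ut yC ->]]]] := (CD.1 v, CD.1 w).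
pose r := undup (s ++ t).
have ur : uniq r by exact: undup_uniq.
have sr : {subset s <= r} by move=> i ?; rewrite mem_undup mem_cat; apply/orP; left.
have tr : {subset t <= r} by move=> i ?; rewrite mem_undup mem_cat; apply/orP; right.
rewrite (sum_widen x us ur sr) (sum_widen y ut ur tr) -sumrB !glue_sum //.
- by rewrite -sumrB; apply: eq_bigr => i _; rewrite phiB.
- by move=> i; case: ifP; rewrite ?yC ?(comp_0 CZ).
- by move=> i; case: ifP; rewrite ?xC ?(comp_0 CZ).
- by move=> i; apply: (comp_B CZ); case: ifP; rewrite ?xC ?yC ?(comp_0 CZ).
Qed.

End DirectSumMaps.

Lemma zmod_morphism0 (U V : zmodType) (f : U -> V) : zmod_morphism f -> f 0 = 0.
Proof. by move=> fB; rewrite -[X in f X](subrr 0) fB subrr. Qed.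

Lemma zmod_morphismD (U V : zmodType) (f : U -> V) :
  zmod_morphism f -> {morph f : v w / v + w}.
Proof.
move=> fB v w.
by rewrite -[w in LHS]opprK -[- w]sub0r !fB (zmod_morphism0 fB) sub0r opprK.
Qed.

(** * The graded module of translates *)

Section Translates.
Variables (F : fieldType) (G : groupType) (A : gradedAlgType F G).
Variable N : lmodType A.
Implicit Types (w : G -> N) (a b : A) (g h k : G).

Definition homog_act w g a : G -> N := fun k => a *: w (g^-1 * k)%g.

Fact homog_actB w g : zmod_morphism (homog_act w g).
Proof. by move=> a b; apply/funext => k; rewrite /homog_act scalerBl. Qed.

(** The action prescribed on homogeneous elements of A, extended additively in
    a: an arbitrary a has no closed formula for its components. *)
Definition fun_act a w : G -> N := glue (@acomp_direct F G A) (homog_act w) a.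

Lemma fun_actE g a w : a \in acomp g -> fun_act a w = homog_act w g a.
Proof. exact/glue_comp/homog_actB/acomp_zmod. Qed.

Lemma fun_actB w : zmod_morphism (fun_act^~ w).
Proof. exact/glueB/homog_actB/acomp_zmod. Qed.

Lemma fun_act0l w : fun_act 0 w = 0.
Proof. exact: zmod_morphism0 (fun_actB w). Qed.

Lemma fun_actDl w : {morph fun_act^~ w : a b / a + b}.
Proof. exact: zmod_morphismD (fun_actB w). Qed.

Lemma fun_actDr a : {morph fun_act a : v w / v + w}.
Proof.
move=> v w; elim/(direct_sum_ind (@acomp_direct F G A)): a.
- by rewrite !fun_act0l addr0.
- by move=> a b ea eb; rewrite !fun_actDl ea eb addrACA.
- move=> g a ag; rewrite !(fun_actE _ ag); apply/funext => k.
  by rewrite /homog_act !addrfctE scalerDr.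
Qed.

Lemma fun_act0r a : fun_act a 0 = 0.
Proof. by apply: (addrI (fun_act a 0)); rewrite -fun_actDr !addr0. Qed.

Lemma fun_actA a b w : fun_act a (fun_act b w) = fun_act (a * b) w.
Proof.
elim/(direct_sum_ind (@acomp_direct F G A)): a.
- by rewrite mul0r !fun_act0l.
- by move=> a a' ea ea'; rewrite mulrDl !fun_actDl ea ea'.
move=> g a ag; elim/(direct_sum_ind (@acomp_direct F G A)): b.
- by rewrite mulr0 !fun_act0l fun_act0r.
- by move=> b b' eb eb'; rewrite mulrDr !fun_actDl fun_actDr eb eb'.
move=> h b bh; rewrite (fun_actE _ bh) (fun_actE _ ag).
rewrite (fun_actE _ (acomp_mul _ _ _ _ ag bh)); apply/funext => k.
by rewrite /homog_act scalerA invgM mulgA.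
Qed.

Lemma fun_act1 w : fun_act 1 w = w.
Proof.
rewrite (fun_actE _ (acomp_one A)); apply/funext => k.
by rewrite /homog_act scale1r invg1 mul1g.
Qed.

Definition supported_at g : {pred G -> N} :=
  fun w => `[< forall k, k != g -> w k = 0 >].

Lemma supported_atP g w :
  reflect (forall k, k != g -> w k = 0) (w \in supported_at g).
Proof. exact: asboolP. Qed.

Lemma supported_at_zmod g : zmod_closed (supported_at g).
Proof.
split=> [|v w /supported_atP vg /supported_atP wg]; apply/supported_atP => k kg //.
by rewrite addrfctE opprfctE vg ?wg ?subrr.
Qed.

(** Finite support, stated as decomposability so that the functions satisfying
    it are by definition the sum of the graded components. *)
Definition fin_supp : {pred G -> N} := fun w => `[< in_sum supported_at w >].

Lemma fin_suppP w : reflect (in_sum supported_at w) (w \in fin_supp).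
Proof. exact: asboolP. Qed.

Lemma fin_supp_zmod : zmod_closed fin_supp.
Proof.
split=> [|v w /fin_suppP iv /fin_suppP iw]; apply/fin_suppP.
  exact: in_sum0 supported_at_zmod.
exact: in_sumB supported_at_zmod _ _ iv iw.
Qed.

Lemma supported_at_fin g w : w \in supported_at g -> w \in fin_supp.
Proof. by move=> wg; apply/fin_suppP/(in_sum_comp supported_at_zmod wg). Qed.

Lemma fin_supp_ind (P : (G -> N) -> Prop) :
  P 0 -> (forall v w, P v -> P w -> P (v + w)) ->
  (forall g w, w \in supported_at g -> P w) ->
  forall w, w \in fin_supp -> P w.
Proof.
move=> P0 PD PC w /fin_suppP[s [x [_ xC ->]]].
by elim/big_ind: _ => // i _; exact: PC (xC i).
Qed.

Lemma fun_act_supported g h a w :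
  a \in acomp g -> w \in supported_at h -> fun_act a w \in supported_at (g * h)%g.
Proof.
move=> ag /supported_atP wh; apply/supported_atP => k kgh.
rewrite (fun_actE _ ag) /homog_act wh ?scaler0 //.
by apply: contraNneq kgh => <-; rewrite mulVKg.
Qed.

Lemma fun_act_fin a w : w \in fin_supp -> fun_act a w \in fin_supp.
Proof.
have fD v v' : v \in fin_supp -> v' \in fin_supp -> v + v' \in fin_supp.
  by move=> /fin_suppP iv /fin_suppP iv'; apply/fin_suppP/(in_sumD supported_at_zmod).
have f0 := fin_supp_zmod.1.
move=> wfin; elim/(direct_sum_ind (@acomp_direct F G A)): a.
- by rewrite fun_act0l.
- by move=> a b fa fb; rewrite fun_actDl fD.
move=> g a ag; elim/fin_supp_ind: wfin => [|v v' fv fv'|h v vh].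
- by rewrite fun_act0r.
- by rewrite fun_actDr fD.
- exact: supported_at_fin (fun_act_supported ag vh).
Qed.

Definition translates := {w : G -> N | w \in fin_supp}.

HB.instance Definition _ := [isSub of translates for @sval _ _].
HB.instance Definition _ := [Choice of translates by <:].
HB.instance Definition _ :=
  GRing.SubChoice_isSubZmodule.Build (G -> N) _ translates fin_supp_zmod.

Definition translates_act a (w : translates) : translates :=
  Sub (fun_act a (val w)) (fun_act_fin a (valP w)).

Fact translates_actA a b (w : translates) :
  translates_act a (translates_act b w) = translates_act (a * b) w.
Proof. by apply: val_inj; rewrite /= fun_actA. Qed.

Fact translates_act1 : left_id 1 translates_act.
Proof. by move=> w; apply: val_inj; rewrite /= fun_act1. Qed.

Fact translates_actDr : right_distributive translates_act +%R.
Proof. by move=> a v w; apply: val_inj; rewrite [RHS]raddfD -fun_actDr -raddfD. Qed.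

Fact translates_actDl (w : translates) : {morph translates_act^~ w : a b / a + b}.
Proof. by move=> a b; apply: val_inj; rewrite raddfD /= fun_actDl. Qed.

HB.instance Definition _ := GRing.Zmodule_isLmodule.Build A translates
  translates_actA translates_act1 translates_actDr translates_actDl.

Definition translates_comp g : {pred translates} :=
  [pred w | val w \in supported_at g].

Fact translates_comp_zmod g : zmod_closed (translates_comp g).
Proof.
have [z0 zB] := supported_at_zmod g.
by split=> [|v w]; rewrite !inE ?raddf0 // => vg wg; rewrite raddfB zB.
Qed.

Fact translates_comp_direct : direct_sum translates_comp.
Proof.
split=> [w|s x us xC E i si].
  have /fin_suppP[s [x [us xC E]]] := valP w.
  exists s, (fun g => Sub (x g) (supported_at_fin (xC g))); split=> //.
  by apply: val_inj; rewrite E raddf_sum; apply: eq_bigr.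
have xC' g := elimT (supported_atP _ _) (xC g).
apply: val_inj; apply/funext => k; have [->|ki] := eqVneq k i; last exact: xC'.
have /(congr1 (@^~ i)) := congr1 val E.
rewrite raddf_sum raddf0 fct_sumE (bigD1_seq i) //= big1 ?addr0 // => g gi.
by apply: xC'; rewrite eq_sym.
Qed.

Fact translates_comp_act g h a (w : translates) :
  a \in acomp g -> w \in translates_comp h -> a *: w \in translates_comp (g * h)%g.
Proof. by rewrite !inE; exact: fun_act_supported. Qed.

HB.instance Definition _ := isGradedMod.Build F G A translates
  translates_comp_zmod translates_comp_direct translates_comp_act.

(** * Right translations *)

Definition shift h w : G -> N := fun k => w (k * h^-1)%g.

Lemma shift_supported g h w :
  w \in supported_at g -> shift h w \in supported_at (g * h)%g.
Proof.
move=> /supported_atP wg; apply/supported_atP => k kgh; apply: wg.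
by apply: contraNneq kgh => <-; rewrite mulgVK.
Qed.

(** Left and right translations of G commute. *)
Lemma shift_act h a w : shift h (fun_act a w) = fun_act a (shift h w).
Proof.
elim/(direct_sum_ind (@acomp_direct F G A)): a => [|a b ea eb|g a ag].
- by rewrite !fun_act0l.
- by rewrite !fun_actDl -ea -eb.
- by rewrite !(fun_actE _ ag); apply/funext => k; rewrite /shift /homog_act mulgA.
Qed.

Lemma shift_fin h w : w \in fin_supp -> shift h w \in fin_supp.
Proof.
elim/fin_supp_ind => [|v v' /fin_suppP iv /fin_suppP iv'|g v vg].
- exact: fin_supp_zmod.1.
- exact/fin_suppP/(in_sumD supported_at_zmod).
- exact: supported_at_fin (shift_supported h vg).
Qed.

Definition shift_end h (w : translates) : translates :=
  Sub (shift h (val w)) (shift_fin h (valP w)).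

Lemma shift_end_deg h : shift_end h \in end_deg (W := translates) h.
Proof.
apply/end_degP; split=> [a v w|g w]; last exact: shift_supported.
apply: val_inj; rewrite [RHS]raddfD /= -shift_act.
by apply/funext.
Qed.

Lemma skew_translates : skew_group_algebra (graded_end translates).
Proof.
pose u h : graded_end translates := Sub (shift_end h) (end_deg_sum (shift_end_deg h)).
have uM g h : u g * u h = u (g * h)%g.
  apply: val_inj; apply/funext => w; apply: val_inj; apply/funext => k /=.
  by rewrite /shift invgM mulgA.
have u1 : u 1%g = 1.
  apply: val_inj; apply/funext => w; apply: val_inj; apply/funext => k /=.
  by rewrite /shift invg1 mulg1.
exists u; split=> // [g|g]; first exact: shift_end_deg.
by exists (u g^-1%g); rewrite !uM mulgV mulVg u1.
Qed.

(** * The component of degree one *)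

Definition eval1 (w : comp_mod translates 1%g) : Defs.restrict N := val (val w) 1%g.

Lemma eval1_linear : linear eval1.
Proof.
move=> a v w; rewrite /eval1 !raddfD /= (fun_actE _ (valP a)) /homog_act.
by rewrite addrfctE invg1 mul1g.
Qed.

Lemma eval1_bij : bijective eval1.
Proof.
pose delta (n : N) : G -> N := fun k => if k == 1%g then n else 0.
have dP n : delta n \in supported_at 1%g.
  by apply/supported_atP => k /negbTE k1; rewrite /delta k1.
pose d n : comp_mod translates 1%g :=
  Sub (Sub (delta n) (supported_at_fin (dP n))) (dP n).
exists d => [w|n]; last by rewrite /eval1 /= /delta eqxx.
apply: val_inj; apply: val_inj; apply/funext => k /=; rewrite /delta.
have [->//|k1] := eqVneq.
by have /supported_atP -> := valP w.
Qed.

End Translates.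

(** * Folding a graded module onto its component of degree one *)

Section Folding.
Variables (F : fieldType) (G : groupType) (A : gradedAlgType F G).
Variables (W : gradedModType A) (sk : skew_group_algebra (graded_end W)).
Implicit Types (a b : A) (v w : W) (g h : G).

Definition translation g : W -> W := val (projT1 (cid sk) g).

Lemma translation_linear g : linear (translation g).
Proof. exact: end_sum_linear (valP _). Qed.

Lemma translationB g : zmod_morphism (translation g).
Proof.
by move=> v w; have := translation_linear g (-1) w v; rewrite !scaleN1r ![- _ + _]addrC.
Qed.

Lemma translationZ g a w : translation g (a *: w) = a *: translation g w.
Proof.
have := translation_linear g a w 0.
by rewrite (linear_fun0 (translation_linear g)) !addr0.
Qed.

Lemma translation_comp g h w :
  w \in wcomp h -> translation g w \in wcomp (h * g)%g.
Proof.
rewrite /translation; case: cid => u /= [uD _ _].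
by have /end_degP[_] := uD g; exact.
Qed.

Lemma translationM g h w : translation h (translation g w) = translation (g * h)%g w.
Proof. by rewrite /translation; case: cid => u /= [_ _ <-]. Qed.

(** An invertible idempotent is the identity. *)
Lemma translation1 w : translation 1%g w = w.
Proof.
rewrite /translation; case: cid => u /= [_ uI uM].
have [v [uv _]] := uI 1%g.
have -> : u 1%g = 1; last by [].
by rewrite -[LHS]mulr1 -uv mulrA uM mulg1.
Qed.

Definition fold : W -> W := glue (@wcomp_direct F G A W) (fun g => translation g^-1%g).

Lemma foldE g w : w \in wcomp g -> fold w = translation g^-1%g w.
Proof. by apply: glue_comp => *; [exact: wcomp_zmod|exact: translationB]. Qed.

Lemma foldB : zmod_morphism fold.
Proof. by apply: glueB => *; [exact: wcomp_zmod|exact: translationB]. Qed.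

Lemma foldD : {morph fold : v w / v + w}.
Proof. exact: zmod_morphismD foldB. Qed.

Lemma fold0 : fold 0 = 0. Proof. exact: zmod_morphism0 foldB. Qed.

Lemma fold_id w : w \in wcomp 1%g -> fold w = w.
Proof. by move=> /foldE ->; rewrite invg1 translation1. Qed.

Lemma fold_in w : fold w \in wcomp 1%g.
Proof.
elim/(direct_sum_ind (@wcomp_direct F G A W)): w => [|v w fv fw|g w wg].
- by rewrite fold0 (comp_0 (@wcomp_zmod F G A W)).
- by rewrite foldD (comp_D (@wcomp_zmod F G A W)).
- by rewrite (foldE wg) -(mulgV g) translation_comp.
Qed.

Lemma fold_translation h w : fold (translation h w) = fold w.
Proof.
elim/(direct_sum_ind (@wcomp_direct F G A W)): w => [|v w fv fw|g w wg].
- by rewrite (zmod_morphism0 (translationB h)).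
- by rewrite (zmod_morphismD (translationB h)) !foldD fv fw.
- by rewrite (foldE (translation_comp h wg)) (foldE wg) translationM invgM mulVKg.
Qed.

(** On the component of degree g, [fold] is a translation, which commutes with
    a and is then absorbed by the outer [fold]. *)
Lemma fold_act_fold a w : fold (a *: fold w) = fold (a *: w).
Proof.
elim/(direct_sum_ind (@wcomp_direct F G A W)): w => [|v w fv fw|g w wg].
- by rewrite fold0.
- by rewrite foldD !scalerDr !foldD fv fw.
- by rewrite (foldE wg) -translationZ fold_translation.
Qed.

(** An alias of the component of degree one, to carry an action of all of [A]
    next to that of the base algebra.  The phantom argument records the units
    on which this action depends. *)
Definition folding (_ : skew_group_algebra (graded_end W)) : Type := comp_mod W 1%g.

HB.instance Definition _ := GRing.Zmodule.on (folding sk).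

Definition fold_act a (w : folding sk) : folding sk :=
  (Sub (fold (a *: val (w : comp_mod W 1%g))) (fold_in _) : comp_mod W 1%g).

Fact fold_actA a b (w : folding sk) : fold_act a (fold_act b w) = fold_act (a * b) w.
Proof. by apply: val_inj; rewrite /= fold_act_fold scalerA. Qed.

Fact fold_act1 : left_id 1 fold_act.
Proof.
move=> w; apply: val_inj; rewrite /= scale1r fold_id //.
exact: valP (w : comp_mod W 1%g).
Qed.

Fact fold_actDr : right_distributive fold_act +%R.
Proof. by move=> a v w; apply: val_inj; rewrite /= scalerDr foldD. Qed.

Fact fold_actDl (w : folding sk) : {morph fold_act^~ w : a b / a + b}.
Proof. by move=> a b; apply: val_inj; rewrite /= scalerDl foldD. Qed.

HB.instance Definition _ := GRing.Zmodule_isLmodule.Build A (folding sk)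
  fold_actA fold_act1 fold_actDr fold_actDl.

Definition to_folding (w : comp_mod W 1%g) : Defs.restrict (folding sk) := w.

(** A_1 W_1 lies in degree 1, where [fold] is the identity. *)
Lemma to_folding_linear : linear to_folding.
Proof.
move=> a v w; apply: val_inj; rewrite /= fold_id //.
exact: comp_act_subproof.
Qed.

End Folding.

(** * Transport of skew group algebras *)

Section Transport.
Variables (F : fieldType) (G : groupType).
Implicit Types (B C : gradedAlgType F G).

Lemma graded_isomorphic_refl B : graded_isomorphic B B.
Proof. by exists (idfun : {rmorphism B -> B}); split=> //; exists id. Qed.

(** The images of the components of b are the components of f b.  If f b has
    degree g, comparing the components of degree g gives f b = f b_g, hence
    b = b_g by injectivity. *)
Lemma graded_iso_reflects B C (f : {rmorphism B -> C}) : injective f ->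
  (forall g b, b \in acomp g -> f b \in acomp g) ->
  forall g b, f b \in acomp g -> b \in acomp g.
Proof.
move=> f_inj fdeg g b fbg.
have [s [x [us xB Eb]]] := (@acomp_direct F G B).1 b.
pose r := undup (g :: s).
have ur : uniq r by exact: undup_uniq.
have sr : {subset s <= r} by move=> h hs; rewrite mem_undup inE hs orbT.
have gr : g \in r by rewrite mem_undup mem_head.
pose y h := if h \in s then x h else 0.
have yB h : y h \in acomp h.
  by rewrite /y; case: ifP; rewrite ?xB ?(comp_0 (@acomp_zmod F G B)).
have Eb' : b = \sum_(h <- r) y h by rewrite Eb (sum_widen x us ur sr).
(* z is the difference of two decompositions of f b, so its sum is zero. *)
pose z h := f (y h) - (if h == g then f b else 0).
have zC h : z h \in acomp h.
  apply: (comp_B (@acomp_zmod F G C)); first exact/fdeg/yB.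
  by case: eqP => [->//|_]; rewrite (comp_0 (@acomp_zmod F G C)).
have sz : \sum_(h <- r) z h = 0.
  rewrite sumrB -rmorph_sum -Eb' (bigD1_seq g) //= eqxx big1 ?addr0 ?subrr //.
  by move=> h /negbTE->.
have := (@acomp_direct F G C).2 r z ur zC sz g gr.
by rewrite /z eqxx => /subr0_eq/f_inj <-.
Qed.

Lemma skew_transport B C :
  graded_isomorphic B C -> skew_group_algebra C -> skew_group_algebra B.
Proof.
move=> [f [f_bij _ fdeg]] [u [uD uI uM]].
have f_inj := bij_inj f_bij; have [f' fK f'K] := f_bij.
exists (f' \o u); split=> [g|g|g h] /=.
- by apply: (graded_iso_reflects f_inj fdeg); rewrite f'K.
- have [v [uv vu]] := uI g; exists (f' v).
  by split; apply: f_inj; rewrite rmorphM !f'K rmorph1.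
- by apply: f_inj; rewrite rmorphM !f'K.
Qed.

End Transport.

Lemma bundle_linear (R : pzRingType) (U V : lmodType R) (f : U -> V) :
  linear f -> bijective f -> exists g : {linear U -> V}, bijective g.
Proof.
move=> fL f_bij; pose e := GRing.isLinear.Build _ _ _ _ f fL.
by exists (HB.pack_for {linear U -> V} f e).
Qed.

Lemma linear_inverse (R : pzRingType) (U V : lmodType R) (f : {linear U -> V}) :
  bijective f -> exists2 f' : V -> U, linear f' & bijective f'.
Proof.
move=> [f' fK f'K]; exists f'; last by exists f.
by move=> a v w; rewrite -[in LHS](f'K v) -[in LHS](f'K w) -linearP fK.
Qed.

(** * The criterion *)

Theorem theorem6p4 (F : fieldType) (G : groupType) (A : gradedAlgType F G)
    (M : lmodType (base_alg A)) :
  restricted_from M <->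
  exists W : gradedModType A,
    (exists f : {linear comp_mod W 1%g -> M}, bijective f) /\
    (exists B : gradedAlgType F G,
       skew_group_algebra B /\ graded_isomorphic (graded_end W) B).
Proof.
split=> [[N [f f_bij]]|[W [[f f_bij] [B [skB isoB]]]]];
  have [f' f'L f'_bij] := linear_inverse f_bij.
  exists (translates N : gradedModType A); split; last first.
    exists (graded_end (translates N)).
    by split; [exact: skew_translates|exact: graded_isomorphic_refl].
  apply: (@bundle_linear _ _ _ (f' \o @eval1 F G A N)).
    by move=> a v w; rewrite /= eval1_linear f'L.
  exact: bij_comp f'_bij (@eval1_bij F G A N).
have sk := skew_transport isoB skB.
exists (folding sk : lmodType A).
apply: (@bundle_linear _ _ _ (@to_folding F G A W sk \o f')).
  by move=> a v w; rewrite /= f'L to_folding_linear.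
by apply: bij_comp => //; exists id.
Qed.
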